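(* Let $m,m_0$ be nonnegative integers, let $l_0$ be a nonnegative integer-valued function on $V(G)$, and let $G$ be an $(m+m_0, l_0)$-partition-connected graph. For each vertex $v$, let $L(v)\subseteq \{m,\ldots, d_G(v)-m_0\}$. If for each vertex $v$, $$|L(v)|\ge d_G(v)+1-l_0(v)-m-m_0,$$ then $G$ has an $m$-tree-connected factor $H$ with $d_H(v)\in L(v)$ for each vertex $v$ such that $G\setminus E(H)$ is $m_0$-tree-connected. When $m_0=0$, $H$ can moreover be chosen to contain an arbitrary given factor of $G$ with maximum degree at most $m$.
   Context: Graphs may have loops and multiple edges. A factor is a spanning subgraph. A graph is $m$-tree-connected if it contains $m$ edge-disjoint spanning trees. For an integer-valued function $l$ on $V(G)$, a graph is $(m,l)$-partition-connected if its edge set can be decomposed into an $m$-tree-connected factor and a factor $F$ which admits an orientation such that the out-degree $d^+_F(v)\ge l(v)$ for each vertex $v$.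
   Formalization: One-vertex graphs are allowed only when m+m_0=0 (with one vertex, no edges, m=1, m_0=0, l_0=0 and L(v) empty the claim fails), and the given factor in the last sentence must have no loops (a loop in it can force a degree outside L(v)); G itself may have loops. *)

(* Defs.v *)
From HB Require Import structures.
From mathcomp Require Import all_boot all_order all_algebra.
From mathcomp Require Import finmap.

Set Implicit Arguments.
Unset Strict Implicit.
Unset Printing Implicit Defensive.

(* Finite multigraphs with vertex type V and edge type E.  The order of the two
   ends carries no information; an edge with equal ends is a loop.  A factor
   (spanning subgraph) is identified with its edge set, a {set E}; the factor
   setT is the graph itself. *)
Record multigraph (V E : finType) := Multigraph { ends : E -> V * V }.

Section Multigraph.
Variables (V E : finType) (G : multigraph V E).
Implicit Types (A F T : {set E}) (e : E) (x y v : V).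

Definition joins e x y : bool := (ends G e == (x, y)) || (ends G e == (y, x)).

Definition is_loop e : bool := (ends G e).1 == (ends G e).2.

(* A loop contributes 2 to the degree of its vertex. *)
Definition degree A v : nat :=
  #|[set e in A | (ends G e).1 == v]| + #|[set e in A | (ends G e).2 == v]|.

Definition adjacent A x y : bool := [exists e in A, joins e x y].

Definition connected A : Prop := forall x y, connect (adjacent A) x y.

(* The cycle v_0 e_0 v_1 e_1 ... v_k e_k v_0 is the sequence of the (v_i, e_i).
   A loop is a cycle of length 1, two parallel edges form one of length 2. *)
Definition is_cycle (c : seq (V * E)) : bool :=
  [&& c != [::], uniq [seq p.1 | p <- c], uniq [seq p.2 | p <- c]
    & cycle (fun p q => joins p.2 p.1 q.1) c].

Definition acyclic A : Prop :=
  forall c, is_cycle c -> ~~ all (fun p => p.2 \in A) c.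

Definition spanning_tree T : Prop := connected T /\ acyclic T.

Definition tree_connected (m : nat) A : Prop :=
  exists T : 'I_m -> {set E},
    [/\ forall i, T i \subset A,
        forall i j, i != j -> [disjoint T i & T j]
      & forall i, spanning_tree (T i)].

(* o e = (tail, head). *)
Definition orientation (o : E -> V * V) F : Prop :=
  forall e, e \in F -> joins e (o e).1 (o e).2.

Definition outdegree (o : E -> V * V) F v : nat :=
  #|[set e in F | (o e).1 == v]|.

Definition partition_connected (m : nat) (l : V -> int) : Prop :=
  exists A F : {set E},
    [/\ A :|: F = setT, [disjoint A & F], tree_connected m A
      & exists2 o : E -> V * V, orientation o F
          & forall v, (l v <= (outdegree o F v)%:Z)%R].

End Multigraph.

(* Main.v *)
Require Import Defs.
From HB Require Import structures.
From mathcomp Require Import all_boot all_order all_algebra.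
From mathcomp Require Import finmap zify.

(* Decompose E(G) into m + m0 spanning trees and a rest F oriented with outdegrees
   at least l0.  The list hypothesis says that at most l0(v) values of
   {m, ..., d(v) - m0} are forbidden at v.  Start with H the union of m of the
   trees; while some vertex v has a forbidden degree in H, add to H an edge of F
   with tail v.  Degrees only grow, so each forbidden value at v costs at most one
   of the edges leaving v, and the m0 other trees are never touched.

   For m0 = 0 it remains to choose the decomposition so that the given factor M
   lies in the tree part.  Seen as a packing of m graphic matroids and, for every
   vertex v, a uniform matroid of rank l0(v) on the edges at v outside M, this is
   the matroid union theorem: a colouring of a maximal set of edges containing M
   has a set R of edges that is spanned by the trace on R of every colour class, and
   counting across the components of R shows that all classes are bases.  The
   bound on the degrees of M enters through: a set Y of vertices meets at most
   m |Y| edges of M, and at most m |Y| / 2 <= m (|Y| - 1) if they all lie inside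
   Y and |Y| >= 2. *)

Lemma connect_ind (T : finType) (e : rel T) (P : T -> Prop) (x y : T) :
  P x -> (forall y z, connect e x y -> P y -> e y z -> P z) ->
  connect e x y -> P y.
Proof.
move=> Px step /connectP[p pp ->]; elim/last_ind: p pp => [|p z IH] //=.
rewrite rcons_path last_rcons => /andP[pp ez].
by apply: step ez; [apply/connectP; exists p|apply: IH].
Qed.

(** * Matroids given by their independent sets: spans and exchanges *)

Section Matroid.
Set Implicit Arguments.
Unset Strict Implicit.
Variable E : finType.

Record matroid (ind : pred {set E}) : Prop := Matroid {
  indep0 : ind set0;
  indepS : forall A B : {set E}, A \subset B -> ind B -> ind A;
  indep_aug : forall A B : {set E}, ind A -> ind B -> #|A| < #|B| ->
    exists2 x, x \in B :\: A & ind (x |: A) }.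

(** For independent [A] this is the closure in the matroid; for dependent [A] it is all of [E],
    which keeps it monotone. *)
Definition mspan (ind : pred {set E}) (A : {set E}) : {set E} :=
  [set x | (x \in A) || ~~ ind (x |: A)].

Section OneMatroid.
Variables (ind : pred {set E}) (Mind : matroid ind).
Implicit Types A B : {set E}.

Lemma sub_mspan A : A \subset mspan ind A.
Proof. by apply/subsetP=> x xA; rewrite inE xA. Qed.

Lemma mspanS A B : A \subset B -> mspan ind A \subset mspan ind B.
Proof.
move=> sAB; apply/subsetP=> x; rewrite !inE => /orP[/(subsetP sAB)->//|nA].
apply/orP; right; apply: contra nA; apply: (indepS Mind); exact: setUS.
Qed.

Lemma mspan_max A B : ind A -> ind B -> B \subset mspan ind A -> #|B| <= #|A|.
Proof.
move=> iA iB sB; rewrite leqNgt; apply/negP=> /(indep_aug Mind iA iB)[x].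
rewrite inE => /andP[xA /(subsetP sB)]; rewrite inE (negPf xA) /=.
by move/negP.
Qed.

(** Both sets are bases of the span of [A]: by [mspan_max] no element of that span can be added to
    [B], and an element outside it that [B] spanned would break augmentation. *)
Lemma mspan_eq_card A B : ind A -> ind B -> #|A| = #|B| ->
  B \subset mspan ind A -> mspan ind B = mspan ind A.
Proof.
move=> iA iB cAB sB; apply/eqP; rewrite eqEsubset; apply/andP; split.
  apply/subsetP=> x xB; apply/negPn/negP=> xA.
  have [xnA ixA] : x \notin A /\ ind (x |: A).
    by move: xA; rewrite inE negb_or negbK => /andP[].
  have [|y] := indep_aug Mind iB ixA; first by rewrite cardsU1 xnA -cAB; lia.
  rewrite !inE => /andP[yB /orP[/eqP yx|yA] iy].
    by move: xB; rewrite inE -yx (negPf yB) iy.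
  have : #|y |: B| <= #|A|.
    apply: mspan_max => //; apply/subUsetP; split=> //.
    by rewrite sub1set inE yA.
  by rewrite cardsU1 yB cAB; lia.
apply/subsetP=> x xA; apply/negPn/negP.
rewrite inE negb_or negbK => /andP[xnB ixB].
have : #|x |: B| <= #|A|.
  by apply: mspan_max => //; apply/subUsetP; split; rewrite ?sub1set.
by rewrite cardsU1 xnB cAB; lia.
Qed.

(** A largest independent set between [x |: A'] and [x |: A] has at least [#|A|] elements, so it
    omits exactly one element [f], which cannot lie in [A']. With [A'] the trace of a colour class
    on [R], the exchanged element falls outside [R]. *)
Lemma exchange_outside A A' x : ind A -> A' \subset A -> x \notin A ->
  ind (x |: A') -> ~~ ind (x |: A) ->
  exists2 f, f \in A :\: A' & ind (x |: (A :\ f)).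
Proof.
move=> iA sA xA iA' nA.
pose P (B : {set E}) := [&& ind B, x |: A' \subset B & B \subset x |: A].
have P0 : P (x |: A') by rewrite /P iA' subxx setUS.
case: (@arg_maxnP _ _ P (fun B => #|B|) P0) => B /and3P[iB sB Bs] Bmax.
have cB : #|A| <= #|B|.
  rewrite leqNgt; apply/negP=> /(indep_aug Mind iB iA)[y].
  rewrite inE => /andP[yB yA] iy.
  have /Bmax : P (y |: B).
    rewrite /P iy (subset_trans sB) ?subsetUr //=.
    by apply/subUsetP; split=> //; rewrite sub1set inE yA orbT.
  by rewrite /= cardsU1 yB; lia.
have /properP[_ [f fxA fB]] : B \proper x |: A.
  rewrite properEneq Bs andbT; apply: contraNneq nA => <-; exact: iB.
have fx : f != x.
  by apply: contraNneq fB => ->; apply: (subsetP sB); rewrite setU11.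
have fA : f \in A by move: fxA; rewrite !inE (negPf fx).
exists f.
  rewrite inE fA andbT; apply: contra fB => fA'.
  by apply: (subsetP sB); rewrite inE fA' orbT.
suff -> : x |: (A :\ f) = B by [].
apply/esym/eqP; rewrite eqEcard; apply/andP; split.
  apply/subsetP=> y yB; have := subsetP Bs _ yB; rewrite !inE.
  case/orP=> [->//|yA]; rewrite yA andbT; apply/orP; right.
  by apply: contraNneq fB => <-.
by rewrite cardsU1 !inE (negPf xA) andbF /= (cardsD1 f A) fA in cB *.
Qed.

End OneMatroid.

(** * Colourings with independent classes: the exchange argument of matroid union *)

Section Colouring.
Variables (I : finType) (ind : I -> pred {set E}).
Hypothesis Mind : forall i, matroid (ind i).
Implicit Types (c : {ffun E -> option I}) (x e f : E).

Definition class c i := [set e | c e == Some i].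
Definition coloured c := [set e | c e != None].
Definition valid c := [forall i, ind i (class c i)].

Definition shift c x f : {ffun E -> option I} :=
  [ffun e => if e == x then c f else if e == f then None else c e].
(** The second component of a state is the hole of the colouring. A step fills the hole with the
    colour of a coloured element, which becomes the new hole. *)
Definition shift_step (s t : {ffun E -> option I} * E) :=
  [&& s.1 t.2 != None, t.1 == shift s.1 s.2 t.2 & valid t.1].

Definition recolour c x i : {ffun E -> option I} :=
  [ffun e => if e == x then Some i else c e].

Lemma valid_recolour c x i : valid c -> c x = None ->
  ind i (x |: class c i) -> valid (recolour c x i).
Proof.
move=> /forallP vc cx ix; apply/forallP=> j.
have [<-|ij] := eqVneq i j.
  suff -> : class (recolour c x i) i = x |: class c i by [].
  by apply/setP=> e; rewrite !inE ffunE; case: (e == x); rewrite ?eqxx.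
suff -> : class (recolour c x i) j = class c j by [].
apply/setP=> e; rewrite !inE ffunE; have [->|//] := eqVneq e x.
by rewrite cx /=; apply/negP=> /eqP[] /eqP; rewrite (negPf ij).
Qed.

Lemma class_shift c x f i : c x = None -> c f = Some i ->
  class (shift c x f) i = x |: (class c i :\ f).
Proof.
move=> cx cf; apply/setP=> e; rewrite !inE ffunE cf.
by case: (e == x); case: (e == f); rewrite ?eqxx.
Qed.

Lemma class_shift_neq c x f i j : c x = None -> c f = Some i -> i != j ->
  class (shift c x f) j = class c j.
Proof.
move=> cx cf ij; have n : (Some i == Some j) = false.
  by apply/negP=> /eqP[] /eqP; rewrite (negPf ij).
apply/setP=> e; rewrite !inE ffunE cf.
have [->|_] := eqVneq e x; first by rewrite cx n.
by have [->|] := eqVneq e f; rewrite ?cf ?n.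
Qed.

(* [R] is the set of elements that can be left uncoloured after a chain of
   single exchanges starting from [c] with [e0] uncoloured; the spans of the
   traces of the colour classes on [R] do not change along such a chain. *)
Lemma tight_set c e0 : valid c -> c e0 = None ->
  (forall c', valid c' -> coloured c' <> e0 |: coloured c) ->
  exists R : {set E}, [/\ e0 \in R, R \subset e0 |: coloured c
    & forall i, R \subset mspan (ind i) (class c i :&: R)].
Proof.
move=> vc ce0 cmax; set J := e0 |: coloured c in cmax *.
pose R := [set x | [exists c', connect shift_step (c, e0) (c', x)]].
pose Inv (s : {ffun E -> option I} * E) :=
  [/\ valid s.1, s.2 \in J & forall e, (s.1 e != None) = (e \in J) && (e != s.2)].
have inv s : connect shift_step (c, e0) s -> Inv s.
  apply: (connect_ind _ _ Inv) => [|[c1 x1] [c2 x2] _ /= [v1 x1J dom1] /and3P[/= cx2 /eqP-> v2]].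
    split=> //=; first by rewrite setU11.
    move=> e; rewrite !inE; have [->|_] /= := eqVneq e e0; first by rewrite ce0.
    by rewrite andbT.
  move: (cx2); rewrite dom1 => /andP[x2J x21].
  split=> // e; rewrite ffunE; have [->|ex1] := eqVneq e x1.
    by rewrite x1J cx2 eq_sym x21.
  by have [->|ex2] := eqVneq e x2; rewrite ?andbF ?andbT // dom1 ex1 andbT.
have none s : connect shift_step (c, e0) s -> s.1 s.2 = None.
  by move=> /inv[_ _ /(_ s.2)]; rewrite eqxx andbF => /negbFE/eqP.
(* Otherwise [x1] either takes colour [i] outright, so that all of [J] is coloured, or displaces an
   element outside [R], which the chain then reaches. *)
have dep c1 x1 i : connect shift_step (c, e0) (c1, x1) ->
    ~~ ind i (x1 |: (class c1 i :&: R)).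
  move=> con; have [/= v1 x1J dom1] := inv _ con; have /= n1 := none _ con.
  apply/negP=> iR; have x1c : x1 \notin class c1 i by rewrite inE n1.
  have iC := forallP v1 i.
  have nC : ~~ ind i (x1 |: class c1 i).
    apply/negP=> /(valid_recolour v1 n1)/cmax; apply.
    apply/setP=> e; rewrite inE ffunE; have [->|ex] := eqVneq e x1.
      by rewrite x1J.
    by rewrite dom1 ex andbT.
  have [f] := exchange_outside (Mind i) iC (subsetIl _ R) x1c iR nC.
  rewrite 3!inE => /andP[+ cf] iF; rewrite cf /= => /negP; apply.
  rewrite inE; apply/existsP; exists (shift c1 x1 f).
  apply: connect_trans con (connect1 _); rewrite /shift_step /= (eqP cf) eqxx /=.
  apply/forallP=> j; have [<-|ij] := eqVneq i j.
    by rewrite class_shift ?(eqP cf).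
  by rewrite (class_shift_neq n1 (eqP cf)) //; exact: (forallP v1).
pose SpanR (s : {ffun E -> option I} * E) :=
  forall i, mspan (ind i) (class s.1 i :&: R) = mspan (ind i) (class c i :&: R).
have spanR s : connect shift_step (c, e0) s -> SpanR s.
  apply: (connect_ind _ _ SpanR) => //= -[c1 x1] [c2 x2] con1 /= IH st i.
  have /= con2 := connect_trans con1 (connect1 st).
  have {st} /and3P[/= cx2 /eqP E2 v2] := st.
  have /= n1 := none _ con1; have [/= v1 _ _] := inv _ con1.
  case c1x2: (c1 x2) cx2 => [j|] // _.
  have [ji|ji] := eqVneq j i; last first.
    by rewrite E2 (class_shift_neq n1 c1x2) // IH.
  subst j; rewrite -IH.
  have x1R : x1 \in R by rewrite inE; apply/existsP; exists c1.
  have x2R : x2 \in R by rewrite inE; apply/existsP; exists c2.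
  (* Within [R] the step swaps [x2] for [x1]. The new trace has the size of the old one and, by
     [dep], lies in its span, so the spans agree. *)
  have Ecl : class c2 i :&: R = x1 |: ((class c1 i :&: R) :\ x2).
    rewrite E2 (class_shift n1 c1x2); rewrite setIUl setIDAC.
    by congr (_ :|: _); apply/setIidPl; rewrite sub1set.
  apply: mspan_eq_card => //.
  - exact: (indepS (Mind i)) (subsetIl _ _) (forallP v1 i).
  - exact: (indepS (Mind i)) (subsetIl _ _) (forallP v2 i).
  - have x1c : x1 \notin class c1 i by rewrite inE n1.
    have x2c : x2 \in class c1 i by rewrite inE c1x2.
    rewrite Ecl cardsU1 (cardsD1 x2 (class c1 i :&: R)) in_setD1 !in_setI.
    by rewrite x2R x2c (negPf x1c) andbF.
  rewrite Ecl; apply/subUsetP; split.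
    by rewrite sub1set inE dep ?orbT.
  by apply: subset_trans (sub_mspan _ _); exact: subD1set.
exists R; split.
- by rewrite inE; apply/existsP; exists c.
- apply/subsetP=> x; rewrite inE => /existsP[c' con].
  by have [_ /= ] := inv _ con.
move=> i; apply/subsetP=> x; rewrite inE => /existsP[c' con].
by rewrite -(spanR _ con i) inE /= dep ?orbT.
Qed.

Lemma card_coloured c (R : {set E}) :
  #|coloured c :&: R| = \sum_i #|class c i :&: R|.
Proof.
have -> : coloured c :&: R = \bigcup_i (class c i :&: R).
  apply/setP=> e; rewrite !inE; apply/andP/bigcupP => [[ce eR]|[i _]].
    case cE: (c e) ce => [i|] // _; exists i => //.
    by rewrite !inE cE eqxx.
  by rewrite !inE => /andP[/eqP-> ->].
rewrite -sum1_card partition_disjoint_bigcup; last first.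
  move=> i j ij; rewrite -setI_eq0; apply/eqP/setP=> e; rewrite !inE.
  apply/negP=> /andP[/andP[/eqP-> _] /andP[/eqP[] /eqP]].
  by rewrite (negPf ij).
by apply: eq_bigr => i _; rewrite sum1_card.
Qed.

(** A colouring with the most coloured elements, among those colouring all of [Y] and nothing
    outside [X], admits no augmentation by one element of [X], as [tight_set] requires. *)
Lemma maximal_tight (X Y : {set E}) c0 : valid c0 -> Y \subset coloured c0 ->
  coloured c0 \subset X ->
  exists c, [/\ valid c, Y \subset coloured c, coloured c \subset X
    & forall e, e \in X :\: coloured c -> exists R : {set E},
        [/\ e \in R, R \subset X
          & forall i, R \subset mspan (ind i) (class c i :&: R)]].
Proof.
move=> v0 Y0 X0.
pose P c := [&& valid c, Y \subset coloured c & coloured c \subset X].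
have P0 : P c0 by rewrite /P v0 Y0.
case: (@arg_maxnP _ _ P (fun c => #|coloured c|) P0) => c /and3P[vc Yc cX] cmax.
exists c; split=> // e; rewrite inE => /andP[ec eX].
have ce : c e = None by move: ec; rewrite inE negbK => /eqP.
have [c' vc' Ec'|R [eR sR tR]] := tight_set vc ce; last first.
  exists R; split=> //; apply: subset_trans sR _.
  by apply/subUsetP; split; rewrite ?sub1set.
have /cmax : P c'.
  rewrite /P vc' Ec' (subset_trans Yc) ?subsetUr //=.
  by apply/subUsetP; split; rewrite ?sub1set.
by rewrite /= Ec' cardsU1 ec; lia.
Qed.

End Colouring.
End Matroid.

(** * Connected components and the graphic matroid *)

Section Forests.
Set Implicit Arguments.
Unset Strict Implicit.
Variables (V E : finType) (G : multigraph V E).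
Implicit Types (A B S T : {set E}) (e : E) (x y v : V).

Local Notation src e := (ends G e).1.
Local Notation tgt e := (ends G e).2.

Lemma joinsC e x y : joins G e x y = joins G e y x.
Proof. by rewrite /joins orbC. Qed.

Lemma joins_ends e : joins G e (src e) (tgt e).
Proof. by rewrite /joins -surjective_pairing eqxx. Qed.

Lemma adjacent_connect_sym S : connect_sym (adjacent G S).
Proof.
apply: sym_connect_sym => x y; apply: eq_existsb => e.
by rewrite joinsC.
Qed.

Lemma adjacent_ends S e : e \in S -> adjacent G S (src e) (tgt e).
Proof. by move=> eS; apply/exists_inP; exists e => //; exact: joins_ends. Qed.

Definition component S x : V := fingraph.root (adjacent G S) x.

Definition components S : nat := #|component S @: setT|.

Lemma component_eq S x y : (component S x == component S y) = connect (adjacent G S) x y.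
Proof. exact: fingraph.root_connect (adjacent_connect_sym S) x y. Qed.

Lemma component_ends S e : e \in S -> component S (src e) = component S (tgt e).
Proof. by move=> eS; apply/eqP; rewrite component_eq connect1 ?adjacent_ends. Qed.

Lemma component_const (W : eqType) (s : V -> W) S x y :
  (forall e, e \in S -> s (src e) = s (tgt e)) ->
  component S x = component S y -> s x = s y.
Proof.
move=> sS /eqP; rewrite component_eq.
apply: (connect_ind _ _ (fun y => s x = s y)) => // {}y z _ -> /exists_inP[e eS].
by case/orP=> /eqP Ee; have := sS e eS; rewrite Ee.
Qed.

Lemma card_const (W : finType) (s : V -> W) S :
  (forall e, e \in S -> s (src e) = s (tgt e)) ->
  #|s @: setT| <= components S.
Proof.
move=> sS; apply: leq_trans (leq_imset_card s _).
apply/subset_leq_card/subsetP=> _ /imsetP[x _ ->].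
apply/imsetP; exists (component S x); first exact: imset_f.
apply: component_const sS _; rewrite /component fingraph.root_root //.
exact: adjacent_connect_sym.
Qed.

(** Identifying the labels at the two ends of one edge loses at most one label; the edges are
    treated one after another. *)
Lemma merge_edges (W : finType) (r : V -> W) S : exists s : V -> W,
  [/\ forall x y, r x = r y -> s x = s y,
      forall e, e \in S -> s (src e) = s (tgt e)
    & #|r @: setT| <= #|s @: setT| + #|S|].
Proof.
elim: {S}_.+1 {-2}S (ltnSn #|S|) => // n IH S; rewrite ltnS => cS.
have [->|[e eS]] := set_0Vmem S.
  by exists r; split=> // [e|]; rewrite ?inE ?cards0 ?addn0.
have cD := cardsD1 e S; rewrite eS in cD.
have [|s [rs sS cs]] := IH (S :\ e); first by lia.
pose t x := if s x == s (src e) then s (tgt e) else s x.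
exists t; split.
- by move=> x y /rs; rewrite /t => ->.
- move=> f fS; rewrite /t; have [->|fe] := eqVneq f e.
    by rewrite eqxx; case: ifP.
  by rewrite sS // !inE fe.
have : #|s @: setT| <= #|t @: setT| + 1.
  apply: (@leq_trans #|s (src e) |: (t @: setT)|); last first.
    by rewrite cardsU1; case: (_ \notin _); lia.
  apply/subset_leq_card/subsetP=> _ /imsetP[x _ ->]; rewrite !inE.
  have [//|ne] := eqVneq (s x) (s (src e)).
  by apply/imsetP; exists x => //; rewrite /t (negPf ne).
by lia.
Qed.

(** Merging labels along the edges of [S] that cross classes of [r] gives a labelling constant on
    every edge of [S], to which [card_const] applies. *)
Lemma card_le_components (W : finType) (r : V -> W) S :
  #|r @: setT| <= components S + #|[set e in S | r (src e) != r (tgt e)]|.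
Proof.
have [s [rs sS cs]] := merge_edges r [set e in S | r (src e) != r (tgt e)].
apply: leq_trans cs _; rewrite leq_add2r; apply: card_const => e eS.
have [/rs//|ne] := eqVneq (r (src e)) (r (tgt e)).
by apply: sS; rewrite inE eS.
Qed.

Lemma components_ge S : #|V| <= components S + #|S|.
Proof.
have := card_le_components id S; rewrite imset_id cardsT => /leq_trans; apply.
rewrite leq_add2l; apply/subset_leq_card/subsetP=> e.
by rewrite inE => /andP[].
Qed.

Lemma components_leD A B : A \subset B -> components A <= components B + #|B :\: A|.
Proof.
move=> sAB; have := card_le_components (component A) B => /leq_trans; apply.
rewrite leq_add2l; apply/subset_leq_card/subsetP=> e; rewrite !inE => /andP[eB ne].
by rewrite eB andbT; apply: contra ne => /component_ends->.
Qed.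

Lemma components_gt0 S : 0 < #|V| -> 0 < components S.
Proof.
by case/card_gt0P=> x _; apply/card_gt0P; exists (component S x); exact: imset_f.
Qed.

Lemma connectedP S : components S <= 1 -> connected G S.
Proof.
by move=> /card_le1P/= h x y; rewrite -component_eq; apply/eqP/esym/eqP;
  have := h _ (imset_f _ (in_setT x)) (component S y); rewrite (imset_f _ (in_setT y)) => /esym.
Qed.

Lemma components_connected S : connected G S -> components S <= 1.
Proof.
move=> cS; apply/card_le1_eqP=> _ _ /imsetP[x _ ->] /imsetP[y _ ->].
by apply/eqP; rewrite component_eq.
Qed.

(* Equivalently, every edge of [S] is a bridge of [S]: see [forest_acyclic]. *)
Definition forest S : bool := components S + #|S| == #|V|.

(** The new components are images of the old ones, and the old component of one end of [e] is
    redundant since that of the other end has the same image. So the count drops; [components_ge]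
    gives the other inequality. *)
Lemma forestU1 A e : forest A -> component A (src e) != component A (tgt e) ->
  forest (e |: A).
Proof.
move=> fA ne; have eA : e \notin A.
  by apply: contra ne => /component_ends->.
rewrite /forest eqn_leq components_ge andbT cardsU1 eA -(eqP fA).
suff : components (e |: A) < components A by lia.
have pA : component A @: setT = component A (src e) |: (component A @: setT :\ component A (src e)).
  by rewrite setD1K // imset_f.
rewrite /components pA cardsU1 !inE eqxx /= ltnS.
apply: leq_trans (leq_imset_card (component (e |: A)) _).
apply/subset_leq_card/subsetP=> _ /imsetP[x _ ->]; apply/imsetP.
have idem y : component (e |: A) y = component (e |: A) (component A y).
  apply: (@component_const _ (component (e |: A)) A) => [f fA'|].
    by apply: component_ends; rewrite inE fA' orbT.
  by rewrite /component fingraph.root_root //; exact: adjacent_connect_sym.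
have [xe|xe] := eqVneq (component A x) (component A (src e)).
  exists (component A (tgt e)); first by rewrite !inE eq_sym ne imset_f.
  by rewrite -idem -(component_ends (setU11 e A)) idem xe -idem.
by exists (component A x); [rewrite !inE xe imset_f|exact: idem].
Qed.

(** For augmentation: if no edge of [B] joins two components of [A], then [A] has at most as many
    components as [B], hence at least as many edges. *)
Lemma forest_matroid : matroid forest.
Proof.
split.
- rewrite /forest eqn_leq components_ge andbT cards0 addn0 -cardsT.
  exact: leq_imset_card.
- move=> A B sAB /eqP fB; rewrite /forest eqn_leq components_ge andbT.
  have := components_leD sAB; have := cardsID A B; rewrite (setIidPr sAB); lia.
move=> A B fA fB cAB.
case: (pickP [pred e in B | component A (src e) != component A (tgt e)]) => [e|no].
  case/andP=> eB ne; exists e; last exact: forestU1.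
  by rewrite inE eB andbT; apply: contra ne => /component_ends->.
have : components A <= components B.
  apply: card_const => e eB; apply/eqP; apply: contraFT (no e) => ne.
  by rewrite /= eB.
by move: (eqP fA) (eqP fB); lia.
Qed.

Lemma forest_mspan A e : forest A -> e \in mspan forest A ->
  component A (src e) = component A (tgt e).
Proof.
move=> fA; rewrite inE => /orP[/component_ends//|]; apply: contraNeq.
exact: forestU1.
Qed.

Lemma cycle_connect S (p q : V * E) (s : seq (V * E)) :
  path (fun p q => joins G p.2 p.1 q.1) p (rcons s q) ->
  all (fun p => p.2 \in S) (p :: s) -> connect (adjacent G S) p.1 q.1.
Proof.
elim: s p => [|a s IH] p /=; first by
  move=> /andP[j _] /andP[pS _]; apply: connect1; apply/exists_inP; exists p.2.
move=> /andP[j pa] /andP[pS aS]; apply: connect_trans (IH a pa aS).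
by apply: connect1; apply/exists_inP; exists p.2.
Qed.

(** The rest of a cycle still connects the ends of [e0], so deleting [e0] creates no component, and
    [components_ge] fails for [S :\ e0]. *)
Lemma forest_acyclic S : forest S -> acyclic G S.
Proof.
move=> fS [|[v0 e0] s] // /and4P[_ _ ue]; rewrite /cycle => pc.
apply/negP=> allS; have eS : e0 \in S by case/andP: allS.
suff con : component (S :\ e0) (src e0) = component (S :\ e0) (tgt e0).
  have : components (S :\ e0) <= components S.
    apply: card_const => e eS'; have [->//|ne] := eqVneq e e0.
    by apply: component_ends; rewrite !inE ne.
  move: (components_ge (S :\ e0)) (eqP fS) (cardsD1 e0 S); rewrite eS; lia.
case: s pc ue allS => [|a s] /=.
  by rewrite andbT => /orP[] /eqP->.
case/andP=> j pc /andP[]; rewrite -/(map _ (a :: s)) => ne _ /andP[_ aS].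
have {}aS : all (fun p => p.2 \in S) (a :: s) by [].
have : connect (adjacent G (S :\ e0)) a.1 v0.
  apply: (cycle_connect pc); apply/allP=> p ps; rewrite !inE.
  have -> : p.2 \in S by exact: (allP aS _ ps).
  by rewrite andbT; apply: contraNneq ne => <-; apply: (map_f snd ps).
rewrite -component_eq => /eqP con.
by case/orP: j => /eqP-> /=.
Qed.

End Forests.

(** * Double counting over finite sets *)

Section FiniteSums.
Set Implicit Arguments.
Unset Strict Implicit.

Lemma card_fibres (T W : finType) (A : {set T}) (f : T -> W) :
  #|A| = \sum_w #|[set x in A | f x == w]|.
Proof.
rewrite -sum1_card (partition_big f xpredT) //=; apply: eq_bigr => w _.
by rewrite -sum1_card; apply: eq_bigl => x; rewrite inE.
Qed.

Lemma card_sum_mem (T : finType) (A : {set T}) (P : pred T) :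
  #|[set x in A | P x]| = \sum_(x in A) P x.
Proof.
rewrite -sum1_card big_mkcond [RHS]big_mkcond /=; apply: eq_bigr => x _.
by rewrite inE; case: (x \in A); case: (P x).
Qed.

Lemma sum_eq_mem (T : finType) (A : {set T}) (a : T) :
  \sum_(x in A) (a == x : nat) = (a \in A).
Proof.
rewrite -(card_sum_mem A (fun x => a == x)); case aA: (a \in A).
  by rewrite (_ : [set _ in _ | _] = [set a]) ?cards1 //;
    apply/setP=> x; rewrite !inE eq_sym; case: eqP => [->|]; rewrite ?aA ?andbF.
apply/eqP; rewrite cards_eq0; apply/eqP/setP=> x; rewrite !inE.
by apply/negP=> /andP[xA /eqP ax]; rewrite ax xA in aA.
Qed.

End FiniteSums.

(** * Degrees and the greedy extension of the tree part *)

Section Degrees.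
Set Implicit Arguments.
Unset Strict Implicit.
Variables (V E : finType) (G : multigraph V E).
Implicit Types (A B F H M S : {set E}) (e : E) (x y v : V).

Local Notation src e := (ends G e).1.
Local Notation tgt e := (ends G e).2.

Lemma degreeE A v :
  degree G A v = \sum_(e in A) ((src e == v) + (tgt e == v)).
Proof. by rewrite /degree !card_sum_mem big_split. Qed.

Lemma sum_degree A (Y : {set V}) :
  \sum_(v in Y) degree G A v = \sum_(e in A) ((src e \in Y) + (tgt e \in Y)).
Proof.
under eq_bigr do rewrite degreeE.
rewrite exchange_big /=; apply: eq_bigr => e _.
by rewrite big_split /= !sum_eq_mem.
Qed.

Lemma degreeU A B v : [disjoint A & B] ->
  degree G (A :|: B) v = degree G A v + degree G B v.
Proof. by move=> dAB; rewrite !degreeE (big_setID A) /= setUK setDUl setDv set0U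
  (setDidPl _) // disjoint_sym. Qed.

Lemma degreeS A B v : A \subset B -> degree G A v <= degree G B v.
Proof.
move=> sAB; rewrite -(setID B A) degreeU; last first.
  by rewrite -setI_eq0 setIDA setIAC -setIDA setDv setI0.
by rewrite (setIidPr sAB) leq_addr.
Qed.

Lemma degree_gt0 A e v : e \in A -> (src e == v) || (tgt e == v) ->
  0 < degree G A v.
Proof.
move=> eA; rewrite /degree addn_gt0 => /orP[] sv; apply/orP; [left|right];
  by apply/card_gt0P; exists e; rewrite inE eA.
Qed.

Lemma degree_component A x y : component G A x = component G A y -> x != y ->
  0 < degree G A x.
Proof.
move/eqP; rewrite component_eq => /connectP[[|z p]] /=; first by move=> _ ->; rewrite eqxx.
case/andP=> /exists_inP[e eA je] _ _ _; apply: degree_gt0 eA _.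
by case/orP: je => /eqP->; rewrite eqxx ?orbT.
Qed.

Lemma tree_connectedS m A B : A \subset B -> tree_connected G m A ->
  tree_connected G m B.
Proof.
by move=> sAB [T [sT dT tT]]; exists T; split=> // i; apply: subset_trans sAB.
Qed.

Lemma sum_disjoint_le (I : finType) (T : I -> {set E}) A (w : E -> nat) :
  (forall i, T i \subset A) -> (forall i j, i != j -> [disjoint T i & T j]) ->
  \sum_i \sum_(e in T i) w e <= \sum_(e in A) w e.
Proof.
move=> sT dT; rewrite -partition_disjoint_bigcup //.
rewrite [leqRHS](big_setID (\bigcup_i T i)) /= (setIidPr _) ?leq_addr //.
by apply/bigcupsP.
Qed.

(** Each tree joins [v] to another vertex and so has an edge at [v]. On a single vertex the empty
    set is a spanning tree, whence the first hypothesis. *)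
Lemma tree_connected_degree m A v : (#|V| = 1 -> m = 0) ->
  tree_connected G m A -> m <= degree G A v.
Proof.
move=> hV [T [sT dT tT]]; rewrite degreeE.
apply: leq_trans (sum_disjoint_le _ sT dT).
rewrite -[leqLHS]card_ord -sum1_card leq_sum // => i _; rewrite -degreeE.
have [y yv] : exists y, y != v.
  apply/existsP; rewrite -[[exists _, _]]negbK; apply/negP=> /existsPn h.
  case: m i hV {T sT dT tT} => [[]//|m] _ hV; suff /hV : #|V| = 1 by [].
  rewrite -cardsT (_ : [set: V] = [set v]) ?cards1 //.
  by apply/setP=> y; rewrite !inE; have := h y; rewrite negbK.
apply: (@degree_component _ v y); last by rewrite eq_sym.
by apply/eqP; rewrite component_eq; case: (tT i).
Qed.

(* Greedy step: while some vertex [v] has a forbidden degree in [H], move an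
   edge with tail [v] from [F] to [H].  The number of forbidden values not below the
   current degree drops at [v], together with its outdegree, and grows nowhere. *)
Lemma extend_to_lists (L : V -> {fset nat}) (o : E -> V * V) H F :
  [disjoint H & F] -> orientation G o F ->
  (forall v, \sum_(degree G H v <= k < (degree G (H :|: F) v).+1) (k \notin L v)
     <= outdegree o F v) ->
  exists2 H' : {set E}, H \subset H' /\ H' \subset H :|: F & forall v, degree G H' v \in L v.
Proof.
elim: {F}_.+1 {-2}F H (ltnSn #|F|) => // n IH F H; rewrite ltnS => cF dHF oF hF.
case: (pickP (fun v => degree G H v \notin L v)) => [v vL|all]; last first.
  by exists H => [|v]; [rewrite subxx subsetUl|apply/negbFE/all].
have degb B w : B \subset H :|: F -> degree G B w < (degree G (H :|: F) w).+1.
  by move=> sB; rewrite ltnS degreeS.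
have : 0 < outdegree o F v.
  by apply: leq_trans (hF v); rewrite big_ltn ?degb ?subsetUl // vL.
case/card_gt0P=> e; rewrite inE => /andP[eF ev].
have eH : e \notin H by apply: contraTN eF => eH; rewrite (disjointFr dHF).
have HF : (e |: H) :|: (F :\ e) = H :|: F.
  by rewrite setUAC setD1K // setUC.
(* Only an inequality, because a loop raises the degree by 2; skipping a value can only lower the
   number of forbidden ones ahead. *)
have degS w : degree G H w + (v == w) <= degree G (e |: H) w.
  rewrite setUC degreeU; last by rewrite disjoint_sym disjoints1.
  rewrite leq_add2l; case: eqP => // <-; apply: (@degree_gt0 _ e); rewrite ?inE //.
  by have := oF e eF; rewrite (eqP ev) => /orP[] /eqP->; rewrite eqxx ?orbT.
have [||||H' [sH Hs] HL] := IH (F :\ e) (e |: H).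
- by move: (cardsD1 e F); rewrite eF; lia.
- rewrite -setI_eq0; apply/eqP/setP=> f; rewrite !inE.
  have [->|fe] //= := eqVneq f e.
  by apply/negP=> /andP[/(disjointFr dHF)->].
- by move=> f; rewrite inE => /andP[_ /oF].
- move=> w; rewrite HF.
  have out : outdegree o F w = (v == w) + outdegree o (F :\ e) w.
    rewrite /outdegree (cardsD1 e) inE eF -(eqP ev) /=; congr (_ + #|pred_of_set _|).
    by apply/setP=> f; rewrite !inE andbA.
  have := hF w; rewrite out.
  have le : degree G (e |: H) w <= (degree G (H :|: F) w).+1.
    by apply/ltnW/degb; rewrite -HF subsetUl.
  have := degS w; have [vw|_] /= := eqVneq v w => dw.
    rewrite -{}vw in le dw *.
    (* The forbidden current degree is the first term of the sum and pays for the edge lost at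
       [v]. *)
    rewrite big_ltn ?degb ?subsetUl // vL leq_add2l => /(leq_trans _); apply.
    by rewrite [leqRHS](@big_cat_nat _ _ _ (degree G (e |: H) v)) ?leq_addl //; lia.
  rewrite add0n => /(leq_trans _); apply.
  by rewrite [leqRHS](@big_cat_nat _ _ _ (degree G (e |: H) w)) ?leq_addl //; lia.
exists H' => //; split; last by rewrite -HF.
by apply: subset_trans sH; rewrite subsetUr.
Qed.

(** The missing values between [c] and [d] and the elements of [L] are distinct members of the
    longer interval. The case [d <= c] is separate because [c] may then exceed [b]. *)
Lemma card_missing (L : {fset nat}) a b c d : a <= c -> d <= b -> 
  (forall k, k \in L -> a <= k < b) ->
  \sum_(c <= k < d) (k \notin L) + #|` L| <= b - a.
Proof.
move=> ac db hL; have [dc|cd] := leqP d c.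
  rewrite big_geq // add0n -(size_iota a (b - a)); apply: uniq_leq_size => // k /hL kab.
  by rewrite mem_iota; lia.
apply: (@leq_trans (\sum_(a <= k < b) (k \notin L) + \sum_(a <= k < b) (k \in L))).
  apply: leq_add.
    rewrite [leqRHS](@big_cat_nat _ _ _ c) //=; last by lia.
    rewrite [X in _ + X](@big_cat_nat _ _ _ d) //=; last by lia.
    by lia.
  have -> : \sum_(a <= k < b) (k \in L) = count [in L] (index_iota a b).
    by rewrite -sumn_count sumnE big_map.
  rewrite -size_filter; apply: uniq_leq_size => // k kL; rewrite mem_filter kL mem_index_iota; exact: hL.
rewrite -big_split /= (eq_bigr (fun=> 1)); last by move=> k _; case: (k \in L).
by rewrite sum_nat_const_nat muln1.
Qed.

(** The trees in [H] and in the complement of [H :|: F] keep every degree met by the greedy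
    extension between [m] and [degree G setT v - m0], so [card_missing] bounds the forbidden ones by
    [l0 v]. *)
Lemma lists_from_decomposition m m0 (l0 : V -> nat) (L : V -> {fset nat})
    (H F : {set E}) (o : E -> V * V) :
  (#|V| = 1 -> m + m0 = 0) ->
  [disjoint H & F] -> tree_connected G m H -> tree_connected G m0 (~: (H :|: F)) ->
  orientation G o F -> (forall v, l0 v <= outdegree o F v) ->
  (forall v k, k \in L v -> m <= k /\ k + m0 <= degree G setT v) ->
  (forall v, degree G setT v + 1 <= #|` L v| + l0 v + m + m0) ->
  exists H' : {set E}, [/\ tree_connected G m H', forall v, degree G H' v \in L v,
    tree_connected G m0 (~: H') & H \subset H'].
Proof.
move=> hV dHF tH tC oF lo hL hcard.
have [//|//|v|H' [sH Hs] HL] := @extend_to_lists L o H F; last first.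
  exists H'; split=> //; first exact: tree_connectedS tH.
  by apply: tree_connectedS tC; rewrite setCS.
apply: leq_trans (lo v).
have d1 : m <= degree G H v by apply: tree_connected_degree tH => /hV; lia.
have d2 : m0 <= degree G (~: (H :|: F)) v.
  by apply: tree_connected_degree tC => /hV; lia.
have dE : degree G (H :|: F) v + degree G (~: (H :|: F)) v = degree G setT v.
  by rewrite -degreeU ?setUCr // -setI_eq0 setICr.
have d3 : degree G H v <= degree G (H :|: F) v by rewrite degreeS ?subsetUl.
have := @card_missing (L v) m (degree G setT v - m0).+1 (degree G H v)
  (degree G (H :|: F) v).+1 d1.
have hLv k : k \in L v -> m <= k < (degree G setT v - m0).+1.
  by move=> /hL; lia.
have := hcard v; move=> hc /(_ _ hLv) le.
suff : (degree G (H :|: F) v).+1 <= (degree G setT v - m0).+1 by move/le; lia.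
by lia.
Qed.

End Degrees.

(** * Decompositions whose tree part contains a given factor *)

Section Decomposition.
Set Implicit Arguments.
Unset Strict Implicit.
Variables (V E : finType) (G : multigraph V E) (m : nat).
Implicit Types (A B F H M S R : {set E}) (e : E) (x y v : V) (Y : {set V}).

Local Notation src e := (ends G e).1.
Local Notation tgt e := (ends G e).2.

Definition touches Y e : bool := (src e \in Y) || (tgt e \in Y).

Lemma uniform_matroid (D : {set E}) (k : nat) :
  matroid (fun S : {set E} => (S \subset D) && (#|S| <= k)).
Proof.
split=> [|A B sAB|A B]; first by rewrite sub0set cards0.
  case/andP=> sB cB; rewrite (subset_trans sAB sB).
  by rewrite (leq_trans (subset_leq_card sAB)).
case/andP=> sA cA /andP[sB cB] cAB.
have /subsetPn[x xB xA] : ~~ (B \subset A).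
  by apply: contraL cAB => /subset_leq_card; rewrite -leqNgt.
exists x; first by rewrite inE xA.
rewrite cardsU1 xA; apply/andP; split; last by lia.
by apply/subUsetP; split=> //; rewrite sub1set (subsetP sB).
Qed.

(** Each of the [m] trees has at least [#|r @: setT| - 1] edges between classes, and [F] has at
    least [l0 v] edges with tail [v] for every [v] in [Y]; these sets of edges are disjoint. *)
Lemma partition_count (l0 : V -> nat) (W : finType) (r : V -> W) Y :
  partition_connected G m (fun v => Posz (l0 v)) ->
  m * #|r @: setT| + \sum_(v in Y) l0 v <=
    m + #|[set e | (r (src e) != r (tgt e)) || touches Y e]|.
Proof.
case=> A [F [AF dAF [T [sT dT tT]] [o oF lo]]].
set Q := [set e | _].
have cQ : #|A :&: Q| + #|F :&: Q| <= #|Q|.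
  rewrite -cardsUI -setIUl AF setTI setIACA.
  by move: dAF; rewrite -setI_eq0 => /eqP->; rewrite set0I cards0 addn0.
have cF : \sum_(v in Y) l0 v <= #|F :&: Q|.
  apply: (@leq_trans (\sum_(v in Y) outdegree o F v)); first
    by apply: leq_sum => v _; have := lo v.
  under eq_bigr do rewrite /outdegree card_sum_mem.
  rewrite exchange_big /= -setIdE card_sum_mem; apply: leq_sum => e eF.
  rewrite sum_eq_mem; case oY: ((o e).1 \in Y) => //.
  by rewrite /touches; case/orP: (oF e eF) => /eqP->; rewrite /= oY ?orbT.
have cA : m * #|r @: setT| <= m + #|A :&: Q|.
  apply: (@leq_trans (\sum_(i < m) (1 + #|T i :&: Q|))).
    rewrite -{1}(card_ord m) -sum_nat_const; apply: leq_sum => i _.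
    apply: leq_trans (card_le_components G r (T i)) _; apply: leq_add.
      by apply: components_connected; case: (tT i).
    apply/subset_leq_card/subsetP=> e; rewrite !inE => /andP[-> ->] //.
  rewrite big_split /= sum1_card card_ord leq_add2l.
  under eq_bigr do rewrite -setIdE card_sum_mem.
  by rewrite -setIdE card_sum_mem; exact: sum_disjoint_le.
by lia.
Qed.

(* The right-hand side counts the classes of the kernel of [r] after all the
   vertices of [Y] have been made singletons. *)
Lemma bounded_degree_count M (r : V -> V) Y :
  (forall e, e \in M -> ~~ is_loop G e) -> (forall v, degree G M v <= m) ->
  #|[set e in M | (r (src e) == r (tgt e)) && touches Y e]| + m * #|r @: setT|
  <= m * #|(fun v => if v \in Y then inl v else inr (r v)) @: [set: V]|.
Proof.
move=> Mloop Mdeg; set S := [set e in M | _]; set s := fun v => _.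
(* [D] collects the classes inside [Y], the only ones that leave no [inr] value behind. *)
pose D := r @: setT :\: r @: ~: Y.
have cs : #|Y| + #|r @: ~: Y| <= #|s @: setT|.
  rewrite -(card_imset _ (@inl_inj V V)) -(card_imset (r @: ~: Y) (@inr_inj V V)).
  rewrite -cardsUI (_ : _ :&: _ = set0) ?cards0 ?addn0; last first.
    apply/setP=> w; rewrite !inE; apply/negP=> /andP[/imsetP[x _ ->]].
    by case/imsetP.
  apply/subset_leq_card/subUsetP; split; apply/subsetP=> _ /imsetP[x xP ->].
    by apply/imsetP; exists x; rewrite // /s xP.
  case/imsetP: xP => y; rewrite inE => yY ->.
  by apply/imsetP; exists y; rewrite // /s (negPf yY).
have cr : #|r @: setT| = #|r @: ~: Y| + #|D|.
  by rewrite -(cardsID (r @: ~: Y)) (setIidPr _) // imsetS.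
suff : #|S| + m * #|D| <= m * #|Y|.
  by rewrite cr; nia.
rewrite (card_fibres S (fun e => r (src e))) (card_fibres Y r).
have -> : #|D| = \sum_w (w \in D).
  by rewrite -sum1_card big_mkcond; apply: eq_bigr => w _; case: (w \in D).
rewrite !big_distrr -big_split /=; apply: leq_sum => w _.
set Sw := [set e in S | _]; set Yw := [set v in Y | _].
have sSw e : e \in Sw -> [/\ e \in M, r (src e) = w, r (tgt e) = w & touches Y e].
  by rewrite !inE => /andP[/and3P[eM /eqP <- tY] /eqP <-].
have degYw : \sum_(e in Sw) ((src e \in Yw) + (tgt e \in Yw)) <= m * #|Yw|.
  rewrite -sum_degree mulnC -sum_nat_const; apply: leq_sum => v _.
  by apply: leq_trans (Mdeg v); apply: degreeS; apply/subsetP=> e /sSw[].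
(* Outside [D], each edge has an end in [Y] and so is counted at least once in the degree sum. *)
case wD: (w \in D) => /=; last first.
  rewrite muln0 addn0; apply: leq_trans degYw; rewrite -sum1_card.
  apply: leq_sum => e /sSw[_ r1 r2]; rewrite !inE r1 r2 eqxx !andbT.
  by rewrite /touches; case: (src e \in Y); case: (tgt e \in Y).
have inY v : r v = w -> v \in Yw.
  move=> rv; rewrite inE rv eqxx andbT; apply: contraTT wD => vY.
  by rewrite !inE negb_and negbK -rv imset_f // inE.
have [x rx] : exists x, r x = w.
  by move: wD; rewrite inE => /andP[_ /imsetP[x _ ->]]; exists x.
have Yw0 : 0 < #|Yw| by apply/card_gt0P; exists x; exact: inY.
(* A class in [D] must save a further [m]. Its edges are counted twice, which suffices for at least
   two vertices; with one vertex only loops could occur. *)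
have cSw : #|Sw| * 2 <= m * #|Yw|.
  apply: leq_trans degYw; rewrite -sum_nat_const; apply: leq_sum => e /sSw[_ r1 r2 _].
  by rewrite !inY.
have [Yw1|Yw2] := leqP #|Yw| 1; last by nia.
suff -> : #|Sw| = 0 by nia.
apply/eqP; rewrite cards_eq0; apply/eqP/setP=> e; rewrite [RHS]inE.
apply/negP=> /sSw[/Mloop/negP nl r1 r2 _]; apply: nl; apply/eqP.
by move/card_le1_eqP: Yw1 => /(_ _ _ (inY _ r1) (inY _ r2)).
Qed.

Section Colours.
Variables (l0 : V -> nat) (M : {set E}).
Hypothesis Mloop : forall e, e \in M -> ~~ is_loop G e.
Hypothesis Mdeg : forall v, degree G M v <= m.

(* Colour [inl i] is meant for the [i]-th tree and colour [inr v] for the edges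
   with tail [v]; the edges of [M] are barred from the latter. *)
Definition colour_indep (i : 'I_m + V) : pred {set E} :=
  match i with
  | inl _ => forest G
  | inr v => fun S => (S \subset [set e in ~: M | touches [set v] e]) && (#|S| <= l0 v)
  end.

Lemma colour_matroid i : matroid (colour_indep i).
Proof. case: i => [i|v]; [exact: forest_matroid|exact: uniform_matroid]. Qed.

Implicit Type c : {ffun E -> option ('I_m + V)}.

Lemma tight_components c R i : valid colour_indep c ->
  R \subset mspan (colour_indep (inl i)) (class c (inl i) :&: R) ->
  forall e, e \in R -> component G (class c (inl i) :&: R) (src e)
    = component G (class c (inl i) :&: R) (tgt e).
Proof.
move=> /forallP/(_ (inl i)) /= fc tR e /(subsetP tR); apply: forest_mspan.
by apply: (indepS (forest_matroid G)) fc; exact: subsetIl.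
Qed.

Lemma card_coloured_sum c R :
  #|coloured c :&: R| = \sum_(i < m) #|class c (inl i) :&: R|
    + \sum_v #|class c (inr v) :&: R|.
Proof. by rewrite card_coloured big_sumType. Qed.

(** If some edge of [M] stayed uncoloured, each tree colour would meet every vertex touched by the
    tight set [R], hence have at least [#|VR| / 2] edges in [R]. Together these are at least
    [m * #|VR| / 2], which bounds [#|R|] from above by the degree condition, yet they miss an edge
    of [R]. *)
Lemma colour_bounded_degree : exists2 c, valid colour_indep c & coloured c = M.
Proof.
pose c0 : {ffun E -> option ('I_m + V)} := [ffun=> None].
have n0 : coloured c0 = set0 by apply/setP=> e; rewrite !inE ffunE.
have v0 : valid colour_indep c0.
  apply/forallP=> i; rewrite (_ : class c0 i = set0).
    exact: (indep0 (colour_matroid i)).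
  by apply/setP=> e; rewrite !inE ffunE.
have [||c [vc _ cM tight]] := @maximal_tight _ _ _ colour_matroid M set0 c0 v0;
  rewrite ?n0 ?sub0set //.
exists c => //; apply/eqP; rewrite eqEsubset cM -setD_eq0; apply/negPn/negP.
case/set0Pn=> e0 e0M; have [R [e0R RM tR]] := tight e0 e0M.
pose VR := [set v | 0 < degree G R v].
have cVR i : #|VR| <= #|class c (inl i) :&: R| * 2.
  set C := class c (inl i) :&: R.
  apply: (@leq_trans (\sum_(v in VR) degree G C v)).
    rewrite -sum1_card; apply: leq_sum => v; rewrite inE => dv.
    have [e eR ev] : exists2 e, e \in R & (src e == v) || (tgt e == v).
      move: dv; rewrite /degree addn_gt0 => /orP[] /card_gt0P[e];
        by rewrite inE => /andP[eR ev]; exists e; rewrite ?ev ?orbT.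
    have := tight_components vc (tR (inl i)) eR; rewrite -/C => ce.
    have ne : src e != tgt e by apply: Mloop; exact: (subsetP RM).
    case/orP: ev => /eqP<-; first exact: degree_component ce ne.
    by apply: degree_component (esym ce) _; rewrite eq_sym.
  rewrite sum_degree -sum_nat_const; apply: leq_sum => e _.
  by case: (_ \in _); case: (_ \in _).
have cR : #|R| * 2 <= m * #|VR|.
  have -> : #|R| * 2 = \sum_(v in [set: V]) degree G R v.
    by rewrite sum_degree -sum_nat_const; apply: eq_bigr => e _; rewrite !inE.
  rewrite (big_setID VR) /= [X in _ + X]big1 ?addn0 => [|v]; last first.
    by rewrite !inE andbT lt0n negbK => /eqP.
  rewrite setTI mulnC -sum_nat_const; apply: leq_sum => v _.
  by apply: leq_trans (Mdeg v); exact: degreeS.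
have : \sum_(i < m) #|class c (inl i) :&: R| < #|R|.
  apply: (@leq_trans #|coloured c :&: R|.+1).
    by rewrite ltnS card_coloured_sum leq_addr.
  apply: proper_card; apply/properP; split; first exact: subsetIr.
  by exists e0 => //; rewrite inE negb_and; case/setDP: e0M => _ ->.
have : m * #|VR| <= (\sum_(i < m) #|class c (inl i) :&: R|) * 2.
  rewrite -{1}(card_ord m) -sum_nat_const big_distrl /=; exact: leq_sum.
by lia.
Qed.

Lemma full_colouring : partition_connected G m (fun v => Posz (l0 v)) ->
  exists c, [/\ valid colour_indep c, M \subset coloured c
    & m * #|V| + \sum_v l0 v <= m + #|coloured c|].
Proof.
move=> hG; have [c1 v1 d1] := colour_bounded_degree.
have [||c [vc Mc _ tight]] := @maximal_tight _ _ _ colour_matroid setT M c1 v1;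
  rewrite ?d1 ?subsetT //.
exists c; split=> //.
pose isT R := [forall i, R \subset mspan (colour_indep i) (class c i :&: R)].
(* A union of tight sets is tight by [mspanS], so one set [R] handles all uncoloured edges at
   once. *)
pose R := \bigcup_(S | isT S) S.
have tR i : R \subset mspan (colour_indep i) (class c i :&: R).
  apply/bigcupsP=> S tS; apply: subset_trans (forallP tS i) _.
  by apply: mspanS (colour_matroid i) _ _ _; apply: setIS; exact: bigcup_sup.
have uR e : e \notin R -> e \in coloured c.
  apply: contraR => ec; have [|S [eS _ tS]] := tight e; first by rewrite in_setD ec in_setT.
  by apply/bigcupP; exists S => //; apply/forallP.
have cC : #|coloured c| = #|~: R| + \sum_(i < m) #|class c (inl i) :&: R|
    + \sum_v #|class c (inr v) :&: R|.
  rewrite -(cardsID R) card_coloured_sum (_ : _ :\: R = ~: R); first by lia.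
  apply/setP=> e; rewrite !inE; case eR: (e \in R) => //=.
  by have := uR e; rewrite eR inE => ->.
have cF : m * #|V| <= \sum_(i < m) #|class c (inl i) :&: R| + m * components G R.
  have sumC k : m * k = \sum_(i < m) k by rewrite sum_nat_const card_ord.
  rewrite !sumC -big_split /=; apply: leq_sum => i _.
  rewrite -(eqP (_ : forest G (class c (inl i) :&: R))); last first.
    by apply: (indepS (forest_matroid G)) (forallP vc (inl i)); exact: subsetIl.
  rewrite addnC leq_add2l; apply: card_const => e eR.
  exact: tight_components (tR _) _ eR.
(* The vertices whose colour is below capacity on [R]. Such a colour spans [R] only if it already
   holds every edge of [R] at [v] outside [M]. *)
pose Y := [set v | #|class c (inr v) :&: R| < l0 v].
have YR e v : e \in R -> e \notin M -> v \in Y -> touches [set v] e -> c e = Some (inr v).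
  move=> eR eM; rewrite inE => cv tv; have := subsetP (tR (inr v)) e eR.
  rewrite inE /= => /orP[|]; first by rewrite !inE => /andP[/eqP].
  case ec: (e \in class c (inr v) :&: R).
    by move: ec; rewrite !inE => /andP[/eqP].
  rewrite cardsU1 ec /= add1n cv andbT => /negP[].
  apply/subUsetP; split; first by rewrite sub1set inE in_setC eM.
  apply: subset_trans (subsetIl _ _) _.
  by have /= /andP[] := forallP vc (inr v).
have sV : \sum_v l0 v <= \sum_(v in Y) l0 v + \sum_(v in ~: Y) #|class c (inr v) :&: R|.
  rewrite (bigID (mem Y)) /= leq_add2l.
  rewrite [leqRHS](eq_bigl (fun v => v \notin Y)); last by move=> v; rewrite inE.
  by apply: leq_sum => v; rewrite inE -leqNgt.
have sC : \sum_v #|class c (inr v) :&: R| = \sum_(v in Y) #|class c (inr v) :&: R|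
    + \sum_(v in ~: Y) #|class c (inr v) :&: R|.
  rewrite (bigID (mem Y)) /=; congr (_ + _).
  by apply: eq_bigl => v; rewrite in_setC.
pose s v : V + V := if v \in Y then inl v else inr (component G R v).
have := partition_count s Y hG; have := bounded_degree_count (component G R) Y Mloop Mdeg.
set mu := [set e in M | _]; rewrite -/(components G R) -/s; set Q := [set e | _].
(* An edge of [R] stays within a component of [R], so it lies in [Q] only by touching [Y]; then it
   is in [M] or has the colour of a vertex of [Y]. *)
have cQ : #|Q| <= #|~: R| + \sum_(v in Y) #|class c (inr v) :&: R| + #|mu|.
  apply: (@leq_trans #|(~: R :|: \bigcup_(v in Y) (class c (inr v) :&: R)) :|: mu|).
    apply/subset_leq_card/subsetP=> e; rewrite [e \in Q]inE => eQ.
    rewrite !in_setU in_setC; case eR: (e \in R) => //=.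
    have ce := component_ends G eR.
    have tY : touches Y e.
      case/orP: eQ => // /negP ne; apply/negPn/negP; rewrite negb_or => /andP[nY1 nY2].
      by apply: ne; rewrite /s (negPf nY1) (negPf nY2) ce.
    case eM: (e \in M); first by rewrite [e \in mu]inE eM ce eqxx tY orbT.
    apply/orP; left; apply/bigcupP.
    have [v vY tv] : exists2 v, v \in Y & touches [set v] e.
      by case/orP: tY => vY; [exists (src e)|exists (tgt e)];
        rewrite // /touches !inE eqxx ?orbT.
    by exists v => //; rewrite !in_setI eR andbT inE (YR e v) ?eM.
  apply: leq_trans (leq_card_setU _ _) _; rewrite leq_add2r.
  apply: leq_trans (leq_card_setU _ _) _; rewrite leq_add2l.
  elim/big_rec2: _ => [|v n S _ IH]; first by rewrite cards0.
  by apply: leq_trans (leq_card_setU _ _) _; rewrite leq_add2l.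
(* The term [#|mu|] cancels between [cQ] and [bounded_degree_count]; [partition_count] for [s] and
   [Y] then closes the count. *)
by lia.
Qed.

(** The count of [full_colouring] equals the sum of the upper bounds on the classes, [#|V| - 1] per
    forest and [l0 v] per vertex, so every class attains its bound. Uncoloured edges join the tree
    part. *)
Lemma decomposition_containing : partition_connected G m (fun v => Posz (l0 v)) ->
  exists A F o, [/\ A :|: F = setT, [disjoint A & F], tree_connected G m A,
    orientation G o F /\ (forall v, l0 v <= outdegree o F v) & M \subset A].
Proof.
move=> hG; have [c [vc Mc]] := full_colouring hG.
rewrite -(setIT (coloured c)) card_coloured_sum.
have dropT (I : finType) (C : I -> {set E}) : \sum_i #|C i :&: setT| = \sum_i #|C i|.
  by apply: eq_bigr => i _; rewrite setIT.
rewrite !dropT => big.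
have fc i : forest G (class c (inl i)) := forallP vc (inl i).
have gc v : (class c (inr v) \subset [set e in ~: M | touches [set v] e])
  && (#|class c (inr v)| <= l0 v) := forallP vc (inr v).
pose F := \bigcup_v class c (inr v).
have FP e : reflect (exists v, c e = Some (inr v)) (e \in F).
  apply: (iffP bigcupP) => [[v _]|[v cv]]; first by rewrite inE => /eqP; exists v.
  by exists v => //; rewrite inE cv.
(* A loop at [v] gets head [v] through the first branch; uncoloured and tree edges keep an arbitrary
   direction. *)
pose o e : V * V := if c e is Some (inr v) then
  (v, if src e == v then tgt e else src e) else ends G e.
have le2 : \sum_v #|class c (inr v)| <= \sum_v l0 v.
  by apply: leq_sum => v _; case/andP: (gc v).
have le1 : 0 < #|V| -> forall i, #|class c (inl i)| + 1 <= #|V|.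
  move=> V0 i; rewrite -(eqP (fc i)) addnC leq_add2r; exact: components_gt0.
exists (~: F), F, o; split.
- by rewrite setUC setUCr.
- by rewrite -setI_eq0 setIC setICr.
- exists (fun i => class c (inl i)); split.
  + move=> i; apply/subsetP=> e; rewrite !inE => /eqP ce.
    by apply/negP=> /FP[v]; rewrite ce.
  + move=> i j ij; rewrite -setI_eq0; apply/eqP/setP=> e; rewrite !inE.
    apply/negP=> /andP[/eqP-> /eqP[] /eqP]; by rewrite (negPf ij).
  move=> i; split; last exact: forest_acyclic (fc i).
  apply: connectedP; have [V0|V0] := leqP #|V| 0.
    by have := eqP (fc i); lia.
  suff : \sum_(j < m) (#|class c (inl j)| + 1) >= m * #|V|.
    rewrite (bigD1 i) //= => ge.
    have le : \sum_(j < m | j != i) (#|class c (inl j)| + 1) <= m.-1 * #|V|.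
      rewrite (_ : m.-1 = #|[pred j : 'I_m | j != i]|); last first.
        by have := cardC1 i; rewrite card_ord => <-.
      by rewrite -sum_nat_const; apply: leq_sum => j _; exact: le1.
    have mV : m * #|V| = #|V| + m.-1 * #|V|.
      by rewrite -mulSn (ltn_predK (ltn_ord i)).
    (* With the other forests at most full, forest [i] has at least [#|V| - 1] edges, hence one
       component. *)
    have {ge le} := leq_trans ge (leq_add (leqnn _) le).
    by rewrite mV leq_add2r -(eqP (fc i)) addnC leq_add2l.
  rewrite big_split /= sum1_card card_ord.
  have arith (a b b' k d : nat) : a + b <= d + (k + b') -> b' <= b -> a <= k + d by lia.
  exact: arith big le2.
- split=> [e /FP[v cv]|v].
    have := subsetP (proj1 (andP (gc v))) e; rewrite !inE cv eqxx => /(_ isT)/andP[_].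
    rewrite /touches !inE /o cv /= /joins; case: (ends G e) => a b /=.
    have [->|av] := eqVneq a v; first by rewrite eqxx.
    by move=> /= /eqP->; rewrite eqxx orbT.
  have -> : outdegree o F v = #|class c (inr v)|.
    congr #|pred_of_set _|; apply/setP=> e; rewrite !inE; apply/andP/eqP.
      by case=> /FP[w cw]; rewrite /o cw /= => /eqP->.
    by move=> cv; split; [apply/FP; exists v|rewrite /o cv].
  have le3 : \sum_(w | w != v) #|class c (inr w)| <= \sum_(w | w != v) l0 w.
    by apply: leq_sum => w _; case/andP: (gc w).
  have : \sum_(i < m) #|class c (inl i)| + m <= m * #|V|.
    rewrite -[X in _ + X](card_ord m) -sum1_card -big_split /=.
    have -> : m * #|V| = \sum_(i < m) #|V| by rewrite sum_nat_const card_ord.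
    apply: leq_sum => i _; apply: le1.
    by apply/card_gt0P; exists v.
  move: big; rewrite (bigD1 v) //= [X in _ <= _ + (_ + X)](bigD1 v) //= => big le4.
  have arith (a b b' k d x y : nat) : a + (x + b) <= d + (k + (y + b')) -> b' <= b ->
    k + d <= a -> x <= y by lia.
  exact: arith big le3 le4.
apply/subsetP=> e eM; rewrite inE; apply/negP=> /FP[v cv].
have := subsetP (proj1 (andP (gc v))) e; rewrite !inE cv eqxx eM.
by move=> /(_ isT).
Qed.

End Colours.
End Decomposition.

Theorem theorem3p3 (V E : finType) (G : multigraph V E) (m m0 : nat)
    (l0 : V -> nat) (L : V -> {fset nat})
    (hV : #|V| = 1 -> m + m0 = 0)
    (hG : partition_connected G (m + m0) (fun v => Posz (l0 v)))
    (hL : forall v k, k \in L v -> m <= k /\ k + m0 <= degree G setT v)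
    (hcard : forall v, degree G setT v + 1 <= #|` L v| + l0 v + m + m0) :
  (exists H : {set E},
      [/\ tree_connected G m H,
          forall v, degree G H v \in L v
        & tree_connected G m0 (~: H)]) /\
  (m0 = 0 ->
   forall M : {set E},
     (forall e, e \in M -> ~~ is_loop G e) ->
     (forall v, degree G M v <= m) ->
     exists H : {set E},
       [/\ tree_connected G m H,
           forall v, degree G H v \in L v,
           tree_connected G m0 (~: H)
         & M \subset H]).
Proof.
split.
  have [A [F [AF dAF [T [sT dT tT]] [o oF lo]]]] := hG.
  (* The first [m] trees start [H]; the last [m0] avoid both [H] and [F], and so survive in the
     complement. *)
  pose H := \bigcup_(i < m) T (lshift m0 i).
  have dHF : [disjoint H & F].
    by apply: disjointWl dAF; apply/bigcupsP=> i _.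
  have tH : tree_connected G m H.
    exists (fun i => T (lshift m0 i)); split=> // [i|i j ij]; first exact: bigcup_sup.
    by apply: dT; rewrite eq_lshift.
  have tC : tree_connected G m0 (~: (H :|: F)).
    exists (fun j => T (rshift m j)); split=> // [j|i j ij]; last first.
      by apply: dT; rewrite eq_rshift.
    rewrite setCU subsetI -!disjoints_subset; apply/andP; split; last first.
      exact: disjointWl dAF.
    rewrite disjoint_sym disjoints_subset; apply/bigcupsP=> i _.
    by rewrite -disjoints_subset dT // eq_lrshift.
  have lo' v : l0 v <= outdegree o F v by have := lo v.
  have [H' [? ? ? _]] := lists_from_decomposition hV dHF tH tC oF lo' hL hcard.
  by exists H'.
move=> m00 M Mloop Mdeg; subst m0; rewrite addn0 in hG.
have [A [F [o [AF dAF tA [oF lo] MA]]]] := decomposition_containing Mloop Mdeg hG.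
have tC : tree_connected G 0 (~: (A :|: F)).
  by exists (fun=> set0); split=> -[].
have [H [? ? ? AH]] := lists_from_decomposition hV dAF tA tC oF lo hL hcard.
by exists H; split=> //; exact: subset_trans AH.
Qed.
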